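(* Let $a>1$ be fixed and let $g\in C_B[0,\infty)$. Then for every $m\in\mathbb{N}$ and every $x\ge 0$, $$|\hat{\mathcal{R}}_{m,a}(g;x)-g(x)|\le 2K_\psi\!\left(g;\frac{u(x)\sqrt{\Lambda_t^2(x)}}{\psi(x)}\right),$$ where $u(x)=\sqrt{x}+\sqrt{1+x}$, $\psi(x)=\sqrt{x(1+x)}$ and $\Lambda_t^2(x)=\hat{\mathcal{R}}_{m,a}((t-x)^2;x)$.
   Context: $C_B[0,\infty)$ is the space of continuous bounded real functions on $[0,\infty)$, and $\|f\|=\sup_{x\ge0}|f(x)|$. For fixed $a>1$, $m\in\mathbb{N}=\{1,2,\dots\}$ and $x\ge 0$, the modified Szász-Mirakjan-Kantorovich operators are $$\hat{\mathcal{R}}_{m,a}(f;x)=m\sum_{k=0}^{\infty}a^{-x/(a^{1/m}-1)}\,\frac{x^k(\log a)^k}{(a^{1/m}-1)^k\,k!}\int_{k/m}^{(k+1)/m}f(t)\,dt,$$ with $\log$ the natural logarithm (and $0^0=1$). In $\hat{\mathcal{R}}_{m,a}((t-x)^2;x)$ the operator acts on the function $t\mapsto (t-x)^2$; this second central moment, denoted $\Lambda_t^2(x)$ (it depends on $m$ and $a$; the superscript 2 is the order of the moment), is explicitly $$\Lambda_t^2(x)=\frac{1-3mx+3m^2x^2}{3m^2}-\frac{2(-1+a^{1/m})(-1+mx)\,x\log a}{(-1+a^{1/m})^2m^2}+\frac{x^2(\log a)^2}{(-1+a^{1/m})^2m^2}.$$ For $\epsilon>0$ the $K$-functional is $$K_\psi(g;\epsilon)=\inf_{f\in\mathcal{W}_\psi[0,\infty)}\{\|f-g\|+\epsilon\|\psi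 f'\|\},$$ where $\mathcal{W}_\psi[0,\infty)=\{f: f\in AC_{loc}[0,\infty),\ \|\psi f'\|<\infty\}$ and $AC_{loc}[0,\infty)$ is the space of functions that are absolutely continuous and differentiable on every compact interval of $[0,\infty)$. *)

(* Defs.v *)
From HB Require Import structures.
From mathcomp Require Import all_boot all_order all_algebra.
From mathcomp Require Import all_classical all_reals all_analysis.

Set Implicit Arguments.
Unset Strict Implicit.
Unset Printing Implicit Defensive.

Import Order.TTheory GRing.Theory Num.Theory.
Import numFieldNormedType.Exports.

Local Open Scope classical_set_scope.
Local Open Scope ring_scope.

(* A function on [0, oo) is represented by a total function R -> R; only its
   values at nonnegative arguments are used. *)

(* C_B[0, oo) *)
Definition CB0y (R : realType) : set (R -> R) :=
  [set g : R -> R |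
    {within `[0, +oo[, continuous g} /\
    exists M : R, forall x : R, 0 <= x -> `|g x| <= M].

(* The value is +oo for unbounded f. *)
Definition supnorm (R : realType) (f : R -> R) : \bar R :=
  ereal_sup [set `|f x|%:E | x in `[0, +oo[%classic].

(* The weight is Poisson of parameter x log a / (a^(1/m) - 1);
   x ^+ 0 = 1 also at x = 0. *)
Definition szasz_kantorovich (R : realType) (m : nat) (a : R)
    (f : R -> R) (x : R) : R :=
  let c := a `^ (m%:R^-1) - 1 in
  m%:R * limn (series (fun k : nat =>
    a `^ (- (x / c)) * ((x ^+ k * ln a ^+ k) / (c ^+ k * k`!%:R)) *
    \int[lebesgue_measure]_(t in `[k%:R / m%:R, k.+1%:R / m%:R]) f t)).

Definition Lambda2 (R : realType) (m : nat) (a x : R) : R :=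
  szasz_kantorovich m a (fun t => (t - x) ^+ 2) x.

Definition abs_continuous (R : realType) (a b : R) (f : R -> R) : Prop :=
  forall e : R, 0 < e -> exists2 d : R, 0 < d &
    forall (n : nat) (l r : 'I_n -> R),
      (forall i, [/\ a <= l i, l i < r i & r i <= b]) ->
      trivIset setT (fun i => `]l i, r i[%classic) ->
      \sum_(i < n) (r i - l i) < d ->
      \sum_(i < n) `|f (r i) - f (l i)| < e.

(* At 0 only the right-hand derivative makes sense. *)
Definition derivable0y (R : realType) (f : R -> R) : Prop :=
  (forall x : R, 0 < x -> derivable f x 1) /\
  cvg (h^-1 * (f h - f 0) @[h --> 0^'+]).

Definition derive0y (R : realType) (f : R -> R) (x : R) : R :=
  if x == 0 then lim (h^-1 * (f h - f 0) @[h --> 0^'+]) else f^`()%classic x.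

Definition ACloc (R : realType) : set (R -> R) :=
  [set f : R -> R |
    (forall a b : R, 0 <= a -> a <= b -> abs_continuous a b f) /\
    derivable0y f].

Definition Wspace (R : realType) (psi : R -> R) : set (R -> R) :=
  [set f : R -> R | ACloc f /\ (supnorm (psi \* derive0y f)%R < +oo)%E].

(* The parameter e ranges over the extended reals, with +oo * 0 = 0: for
   e = +oo only the f with psi f' = 0 contribute a finite value. *)
Definition Kfunctional (R : realType) (psi : R -> R) (g : R -> R)
    (e : \bar R) : \bar R :=
  ereal_inf [set (supnorm (f \- g)%R + e * supnorm (psi \* derive0y f)%R)%E
            | f in Wspace psi].

Definition u_fun (R : realType) (x : R) : R :=
  Num.sqrt x + Num.sqrt (1 + x).

Definition psi_fun (R : realType) (x : R) : R := Num.sqrt (x * (1 + x)).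

(* Main.v *)
(* As [u >= 1], the function [u y = sqrt y + sqrt (1 + y)] satisfies
   [u' = u / (2 psi) >= 1 / (2 psi)].
   Hence for [f] in [W_psi] with [N = ||psi f'||] both [2 N u + f] and
   [2 N u - f] are nondecreasing, so
   [|f t - f x| <= 2 N |u t - u x| <= 2 N |t - x| u x / psi x].
   With [D = ||f - g||] this gives
   [|g t - g x| <= 2 D + 2 N (u x / psi x) |t - x|], and averaging over [t]
   against the operator, a probability measure with second moment [Lambda2]
   about [x], yields the bound for each [f].  At [x = 0] the parameter of the
   K-functional is [+oo], so only [N = 0], that is constant [f], matters. *)
Require Import Defs.
From HB Require Import structures.
From mathcomp Require Import all_boot all_order all_algebra.
From mathcomp Require Import all_classical all_reals all_analysis.
From mathcomp Require Import ring lra zify.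

Set Implicit Arguments.
Unset Strict Implicit.
Unset Printing Implicit Defensive.

Import Order.TTheory GRing.Theory Num.Theory.
Import numFieldNormedType.Exports.

Local Open Scope classical_set_scope.
Local Open Scope ring_scope.

(** * Integrals over the cells [[k/m, (k+1)/m]] *)

Definition cell_integral (R : realType) (m : nat) (f : R -> R) (k : nat) : R :=
  \int[lebesgue_measure]_(t in `[k%:R / m%:R, k.+1%:R / m%:R]) f t.

Lemma integrable_cell (R : realType) (m k : nat) (f : R -> R) :
  {within `[0, +oo[, continuous f} ->
  (@lebesgue_measure R).-integrable `[k%:R / m%:R, k.+1%:R / m%:R] (EFin \o f).
Proof.
move=> cf; apply: continuous_compact_integrable; first exact: segment_compact.
apply: continuous_subspaceW cf => t /=; rewrite !in_itv/= andbT => /andP[kt _].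
by apply: le_trans kt; rewrite divr_ge0.
Qed.

Lemma cell_integral_cst (R : realType) (m k : nat) (c : R) : (0 < m)%N ->
  cell_integral m (fun=> c) k = c / m%:R.
Proof.
move=> m0; rewrite /cell_integral Rintegral_cst//= lebesgue_measure_itv/= lte_fin.
rewrite ltr_pM2r ?invr_gt0 ?ltr0n// ltr_nat ltnSn -EFinB/= -mulrBl.
by rewrite -natr1 addrAC subrr add0r div1r.
Qed.

Lemma le_cell_integral (R : realType) (m k : nat) (f g : R -> R) :
  {within `[0, +oo[, continuous f} -> {within `[0, +oo[, continuous g} ->
  (forall t, 0 <= t -> k%:R / m%:R <= t <= k.+1%:R / m%:R -> f t <= g t) ->
  cell_integral m f k <= cell_integral m g k.
Proof.
move=> cf cg fg; apply: le_Rintegral => //; try exact: integrable_cell.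
move=> t /=; rewrite in_itv/= => tk; apply: fg => //.
by case/andP: tk => kt _; apply: le_trans kt; rewrite divr_ge0.
Qed.

Lemma continuous_sqr_dist (R : realType) (x : R) :
  continuous (fun t : R => (t - x) ^+ 2).
Proof.
move=> t; apply: (@continuous_comp _ _ _ (fun t : R => t - x) (fun t => t ^+ 2)).
  by apply: cvgB; [exact: cvg_id|exact: cvg_cst].
exact: exprn_continuous.
Qed.

Lemma cell_integral_affine (R : realType) (m k : nat) (x b c : R) : (0 < m)%N ->
  cell_integral m (fun t => c + b * (t - x) ^+ 2) k =
  c / m%:R + b * cell_integral m (fun t => (t - x) ^+ 2) k.
Proof.
move=> m0; have cs : {within `[0, +oo[, continuous (fun t : R => (t - x) ^+ 2)}.
  by apply: continuous_subspaceT; exact: continuous_sqr_dist.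
rewrite /cell_integral RintegralD//.
- rewrite RintegralZl//; last exact: integrable_cell.
  by congr (_ + _); exact: cell_integral_cst.
- apply: integrable_cell; apply: continuous_subspaceT => t; exact: cvg_cst.
- apply: integrable_cell; apply: continuous_subspaceT => t.
  by apply: cvgM; [exact: cvg_cst|exact: continuous_sqr_dist].
Qed.

(** * Poisson weights and convergence of the series *)

Lemma cvg_series_affine (R : realType) (u v : R^nat) (b c : R) :
  cvgn (series u) -> cvgn (series v) ->
  series (fun k => b * u k + c * v k) @ \oo -->
    b * limn (series u) + c * limn (series v).
Proof.
move=> cu cv.
have -> : series (fun k => b * u k + c * v k) =
    (fun n => b * series u n + c * series v n).
  by apply/funext => n; rewrite /series/= big_split/= !mulr_sumr.
by apply: cvgD; apply: cvgM => //; exact: cvg_cst.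
Qed.

Definition poisson_weight (R : realType) (l : R) (k : nat) : R :=
  expR (- l) * exp_coeff l k.

Lemma poisson_weight_ge0 (R : realType) (l : R) (k : nat) : 0 <= l ->
  0 <= poisson_weight l k.
Proof. by move=> l0; rewrite mulr_ge0 ?expR_ge0// exp_coeff_ge0. Qed.

Lemma is_cvg_poisson_weight (R : realType) (l : R) :
  cvgn (series (poisson_weight l)).
Proof. exact: is_cvg_seriesZ (is_cvg_series_exp_coeff l). Qed.

Lemma poisson_weight_sum (R : realType) (l : R) :
  limn (series (poisson_weight l)) = 1.
Proof.
have -> : poisson_weight l = expR (- l) *: exp_coeff l by [].
rewrite lim_seriesZ; last exact: is_cvg_series_exp_coeff.
by rewrite -[RHS](expRxMexpNx_1 l) mulrC.
Qed.

(** Comparison with an exponential series: on the [k]-th cell [|t - x| <= (k+1) (1+x)], and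
    [(k+1)^2 <= 4 * 2^k]. The factor [2^k] is absorbed by doubling the parameter, whence
    [exp_coeff (l * 2)]. *)
Lemma is_cvg_poisson_second_moment (R : realType) (m : nat) (l x : R) :
  (0 < m)%N -> 0 <= l -> 0 <= x ->
  cvgn (series (fun k =>
    poisson_weight l k * cell_integral m (fun t => (t - x) ^+ 2) k)).
Proof.
move=> m0 l0 x0; have m1 : 1 <= m%:R :> R by rewrite ler1n.
have csq : {within `[0, +oo[, continuous (fun t : R => (t - x) ^+ 2)}.
  by apply: continuous_subspaceT; exact: continuous_sqr_dist.
pose C : R := expR (- l) * (4 * (1 + x) ^+ 2).
apply: (@series_le_cvg _ _ (C *: exp_coeff (l * 2))) => [k|k|k|].
- rewrite mulr_ge0 ?poisson_weight_ge0// Rintegral_ge0// => t _.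
  exact: sqr_ge0.
- rewrite /C; apply: mulr_ge0; last by apply: exp_coeff_ge0; rewrite mulr_ge0.
  by rewrite !mulr_ge0 ?expR_ge0 ?addr_ge0.
- have pow2 : k.+1%:R ^+ 2 <= 4 * 2 ^+ k :> R.
    rewrite -natrX -(natrX _ 2) -natrM ler_nat.
    (* The inductive step rests on [(n+2)^2 <= 2 (n+1)^2], which fails for [n < 2]; the first values
       are therefore checked directly. *)
    elim: k => // -[//|[//|k]] IH; rewrite [leqRHS](_ : _ = 2 * (4 * 2 ^ k.+2))%N.
      apply: leq_trans (leq_mul (leqnn 2) IH).
      by rewrite -!mulnn; nia.
    by rewrite (expnS 2 k.+2) mulnCA.
  have cell : cell_integral m (fun t => (t - x) ^+ 2) k <=
      4 * (1 + x) ^+ 2 * 2 ^+ k.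
    apply: (@le_trans _ _ (cell_integral m (fun=> (k.+1%:R * (1 + x)) ^+ 2) k)).
      apply: le_cell_integral => //.
        by apply: continuous_subspaceT => t; exact: cvg_cst.
      move=> t t0 /andP[_ tk].
      have tk1 : t <= k.+1%:R.
        by apply: le_trans tk _; rewrite ler_pdivrMr ?ltr0n// ler_peMr.
      have k1 : 1 <= k.+1%:R :> R by rewrite ler1n.
      rewrite -ler_sqrt ?sqr_ge0// !sqrtr_sqr ler_norml.
      rewrite [`|_ * _|]ger0_norm ?mulr_ge0 ?addr_ge0//.
      by apply/andP; split; nra.
    rewrite cell_integral_cst// ler_pdivrMr ?ltr0n//.
    have h0 : 0 <= (1 + x) ^+ 2 by exact: sqr_ge0.
    have h1 : 0 <= 2 ^+ k :> R by rewrite exprn_ge0.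
    rewrite exprMn (le_trans (ler_wpM2r h0 pow2))//.
    by rewrite mulrAC ler_peMr ?mulr_ge0 ?addr_ge0.
  rewrite -[leRHS]/(C * exp_coeff (l * 2) k).
  have -> : C * exp_coeff (l * 2) k =
      poisson_weight l k * (4 * (1 + x) ^+ 2 * 2 ^+ k).
    by rewrite /C /poisson_weight /exp_coeff /= exprMn; ring.
  by apply: ler_wpM2l cell; exact: poisson_weight_ge0.
- exact: is_cvg_seriesZ (is_cvg_series_exp_coeff _).
Qed.

(** * The operator as a Poisson average *)

Lemma szasz_kantorovichE (R : realType) (m : nat) (a x : R) (f : R -> R) :
  1 < a -> let l := x * ln a / (a `^ m%:R^-1 - 1) in
  szasz_kantorovich m a f x =
  m%:R * limn (series (fun k => poisson_weight l k * cell_integral m f k)).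
Proof.
move=> a1 l; rewrite /szasz_kantorovich.
apply: (congr1 (fun v : R^nat => m%:R * limn (series v))).
apply/funext => k; congr (_ * _).
rewrite /poisson_weight /exp_coeff /= {1}/powR gt_eqF ?(lt_trans ltr01)//.
congr (expR _ * _); first by rewrite /l; ring.
by rewrite /l exprMn exprVn exprMn invfM; ring.
Qed.

Lemma poisson_parameter_ge0 (R : realType) (m : nat) (a x : R) :
  (0 < m)%N -> 1 < a -> 0 <= x -> 0 <= x * ln a / (a `^ m%:R^-1 - 1).
Proof.
move=> m0 a1 x0; have la : 0 <= ln a by rewrite ln_ge0// ltW.
rewrite divr_ge0 ?mulr_ge0// subr_ge0 /powR gt_eqF ?(lt_trans ltr01)//.
by rewrite -expR0 ler_expR mulr_ge0 ?invr_ge0.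
Qed.

(** Positivity of the operator: [g] lies between the two quadratics [g x - A - B (t-x)^2] and
    [g x + A + B (t-x)^2], whose images are known because the weights sum to 1. *)
Lemma szasz_kantorovich_dist (R : realType) (m : nat) (a x : R) (g : R -> R)
    (A B : R) :
  (0 < m)%N -> 1 < a -> 0 <= x -> {within `[0, +oo[, continuous g} ->
  (forall t, 0 <= t -> `|g t - g x| <= A + B * (t - x) ^+ 2) ->
  `|szasz_kantorovich m a g x - g x| <= A + B * Lambda2 m a x.
Proof.
move=> m0 a1 x0 cg dg; rewrite /Lambda2 !szasz_kantorovichE//=.
have := poisson_parameter_ge0 m0 a1 x0.
set l := x * ln a / _ => l0.
have mR0 : m%:R != 0 :> R by rewrite pnatr_eq0 -lt0n.
pose q k := poisson_weight l k * cell_integral m (fun t => (t - x) ^+ 2) k.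
pose e k := poisson_weight l k * cell_integral m g k.
(* [aff c b] is the series term for [c + b (t-x)^2]. A cell has length [1/m], hence [c / m]; the
   factor [m] of the operator restores [c]. *)
pose aff c b k := c / m%:R * poisson_weight l k + b * q k.
have cq : cvgn (series q) by exact: is_cvg_poisson_second_moment.
have cw := @is_cvg_poisson_weight _ l.
have caff c b : series (aff c b) @ \oo --> c / m%:R + b * limn (series q).
  have := @cvg_series_affine _ _ _ (c / m%:R) b cw cq.
  by rewrite poisson_weight_sum mulr1.
have laff c b := cvg_lim (@norm_hausdorff _ _) (caff c b).
have {}caff c b := cvgP _ (caff c b).
have affE c b k : aff c b k =
    poisson_weight l k * cell_integral m (fun t => c + b * (t - x) ^+ 2) k.
  by rewrite cell_integral_affine// /aff /q; ring.
have cbound c b :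
    {within `[0, +oo[, continuous (fun t : R => c + b * (t - x) ^+ 2)}.
  apply: continuous_subspaceT => t; apply: cvgD; first exact: cvg_cst.
  by apply: cvgM; [exact: cvg_cst|exact: continuous_sqr_dist].
have lo k : aff (g x - A) (- B) k <= e k.
  rewrite affE; apply: ler_wpM2l; first exact: poisson_weight_ge0.
  apply: le_cell_integral => // t t0 _; move: (dg t t0); rewrite ler_norml.
  by lra.
have hi k : e k <= aff (g x + A) B k.
  rewrite affE; apply: ler_wpM2l; first exact: poisson_weight_ge0.
  apply: le_cell_integral => // t t0 _; move: (dg t t0); rewrite ler_norml.
  by lra.
(* The terms [e k] may change sign, so the comparison test is applied to [e] minus its lower bound,
   which is nonnegative and dominated by the gap between the two bounds. *)
have ce : cvgn (series e).
  have -> : e = (e - aff (g x - A) (- B)) + aff (g x - A) (- B) by rewrite subrK.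
  apply: is_cvg_seriesD => //.
  apply: (@series_le_cvg _ _ (aff (g x + A) B - aff (g x - A) (- B))).
  - by move=> k; rewrite subr_ge0.
  - by move=> k; rewrite subr_ge0 (le_trans (lo k)).
  - by move=> k; rewrite lerD2r.
  - exact: is_cvg_seriesB.
have := lim_series_le (caff _ _) ce lo.
have := lim_series_le ce (caff _ _) hi.
rewrite !laff -/e -/q.
set E := limn (series e); set Q := limn (series q) => h1 h2.
have mp : 0 < m%:R :> R by rewrite ltr0n.
have := ler_wpM2l (ltW mp) h1; have := ler_wpM2l (ltW mp) h2.
rewrite !mulrDr !(mulrCA m%:R _ m%:R^-1) !divff// !mulr1.
rewrite ler_norml => h3 h4; apply/andP; split; lra.
Qed.

(** * The comparison function [u] *)

Lemma u_fun_ge0 (R : realType) (x : R) : 0 <= u_fun x.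
Proof. by rewrite addr_ge0 ?sqrtr_ge0. Qed.

Lemma u_fun_ge1 (R : realType) (x : R) : 0 <= x -> 1 <= u_fun x.
Proof.
move=> x0; rewrite /u_fun -[leLHS]add0r lerD ?sqrtr_ge0//.
by rewrite -[leLHS]sqrtr1 ler_sqrt ?lerDl// addr_ge0.
Qed.

Lemma is_derive_u_fun (R : realType) (x : R) : 0 < x ->
  is_derive x 1 (@u_fun R) (u_fun x / (2 * psi_fun x)).
Proof.
move=> x0; have x1 : 0 < 1 + x by rewrite addr_gt0.
have d0 := is_derive1_sqrt x0.
have d1 : is_derive x 1 (fun t : R => Num.sqrt (1 + t))
    (2 * Num.sqrt (1 + x))^-1.
  rewrite -[X in is_derive _ _ _ X]mulr1.
  apply: (@is_derive1_comp _ Num.sqrt (fun t => 1 + t)).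
    exact: is_derive1_sqrt.
  by rewrite -[1%R in X in is_derive _ _ _ X]add0r; apply: is_deriveD.
apply: is_derive_eq (is_deriveD d0 d1) _.
rewrite /u_fun /psi_fun sqrtrM ?(ltW x0)//.
have s0 : Num.sqrt x != 0 by rewrite gt_eqF ?sqrtr_gt0.
have s1 : Num.sqrt (1 + x) != 0 by rewrite gt_eqF ?sqrtr_gt0.
by field; rewrite s0 s1.
Qed.

Lemma continuous_u_fun (R : realType) : continuous (@u_fun R).
Proof.
move=> x; apply: cvgD; first exact: sqrt_continuous.
apply: (@continuous_comp _ _ _ (fun t : R => 1 + t) Num.sqrt).
  by apply: cvgD; [exact: cvg_cst|exact: cvg_id].
exact: sqrt_continuous.
Qed.

(** Rationalizing each root gives [|sqrt s - sqrt y| <= |s - y| / sqrt y], on either side of [y].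
    The two slopes [1 / sqrt x] and [1 / sqrt (1+x)] add up to [u x / psi x]. *)
Lemma u_fun_dist (R : realType) (x t : R) : 0 < x -> 0 <= t ->
  `|u_fun t - u_fun x| <= `|t - x| * (u_fun x / psi_fun x).
Proof.
have sqrt_dist (y s : R) : 0 < y -> 0 <= s ->
    `|Num.sqrt s - Num.sqrt y| <= `|s - y| / Num.sqrt y.
  move=> y0 s0; rewrite ler_pdivlMr ?sqrtr_gt0//.
  have -> : s - y = (Num.sqrt s - Num.sqrt y) * (Num.sqrt s + Num.sqrt y).
    by rewrite -subr_sqr !sqr_sqrtr// ltW.
  by rewrite normrM ler_wpM2l// ger0_norm ?addr_ge0 ?sqrtr_ge0// lerDr sqrtr_ge0.
move=> x0 t0; have x1 : 0 < 1 + x by rewrite addr_gt0.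
have h0 := sqrt_dist x t x0 t0.
have h1 := sqrt_dist (1 + x) (1 + t) x1 (addr_ge0 ler01 t0).
have -> : u_fun t - u_fun x = (Num.sqrt t - Num.sqrt x) +
    (Num.sqrt (1 + t) - Num.sqrt (1 + x)) by rewrite /u_fun; ring.
apply: le_trans (ler_normD _ _) _; apply: le_trans (lerD h0 h1) _.
have -> : 1 + t - (1 + x) = t - x by ring.
rewrite /u_fun /psi_fun sqrtrM ?(ltW x0)//.
have s0 : Num.sqrt x != 0 by rewrite gt_eqF ?sqrtr_gt0.
have s1 : Num.sqrt (1 + x) != 0 by rewrite gt_eqF ?sqrtr_gt0.
rewrite le_eqVlt; apply/orP; left; apply/eqP.
by field; rewrite s0 s1.
Qed.

(** * Increments of locally absolutely continuous functions *)

Lemma abs_continuous_within (R : realType) (a b : R) (f : R -> R) :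
  abs_continuous a b f -> {within `[a, b], continuous f}.
Proof.
move=> acf; apply/subspace_continuousP => y /= yab.
apply/cvgrPdist_lt => e e0; have [d d0 acd] := acf e e0.
have close (p q : R) : a <= p -> q <= b -> p < q -> q - p < d ->
    `|f q - f p| < e.
  move=> ap qb pq qpd.
  (* A family of one interval already yields uniform continuity. *)
  have := acd 1%N (fun=> p) (fun=> q); rewrite !big_ord1; apply => //.
  by move=> i j _ _ _; rewrite (ord1 i) (ord1 j).
move: yab; rewrite in_itv/= => /andP[ay yb].
exists d => //= z yz zab; move: zab; rewrite /= in_itv/= => /andP[az zb].
case: (ltgtP y z) => [ltyz|ltzy|->].
- by rewrite distrC close// (le_lt_trans _ yz)// distrC ler_norm.
- by rewrite close// (le_lt_trans _ yz)// ler_norm.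
- by rewrite subrr normr0.
Qed.

(** Derivatives enter only at interior points, so [x = 0] is covered although [u] is not
    differentiable there: continuity suffices at the endpoints. *)
Lemma ACloc_dist_u_fun (R : realType) (f : R -> R) (N x t : R) :
  ACloc f -> (forall y, 0 < y -> `|psi_fun y * f^`()%classic y| <= N) ->
  0 <= x -> 0 <= t -> `|f t - f x| <= 2 * N * `|u_fun t - u_fun x|.
Proof.
move=> [acf [df _]] fN.
wlog xt : x t / x <= t.
  move=> H x0 t0; have [xt|/ltW tx] := leP x t; first exact: H.
  by rewrite distrC [X in _ * X]distrC H.
move=> x0 _.
have N0 : 0 <= N by apply: le_trans (fN 1 ltr01).
(* The sign [s] treats [2 N u + f] and [2 N u - f] together. *)
have mono (s : R) : `|s| = 1 ->
    2 * N * u_fun x + s * f x <= 2 * N * u_fun t + s * f t.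
  move=> s1; pose h y := 2 * N * u_fun y + s * f y.
  have dh (y : R) : 0 < y -> is_derive y 1 h
      (2 * N * (u_fun y / (2 * psi_fun y)) + s * f^`()%classic y).
    move=> y0; have du := is_derive_u_fun y0.
    have dfy : is_derive y 1 f (f^`()%classic y).
      by rewrite derive1E; apply: DeriveDef => //; exact: df.
    by apply: is_deriveD; apply: is_deriveZ.
  apply: (@ger0_derive1_ndecr _ h x t) => //.
  - move=> y; rewrite in_itv/= => /andP[xy _].
    by have [] := dh y (le_lt_trans x0 xy).
  - move=> y; rewrite in_itv/= => /andP[xy _].
    have y0 := le_lt_trans x0 xy; have dhy := dh y y0.
    rewrite derive1E derive_val.
    have p0 : 0 < psi_fun y by rewrite sqrtr_gt0 mulr_gt0// addr_gt0.
    have u1 := u_fun_ge1 (ltW y0).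
    have sf : - N <= s * (psi_fun y * f^`()%classic y).
      have := fN y y0; rewrite -[leLHS]mul1r -s1 -normrM ler_norml.
      by case/andP.
    have -> : 2 * N * (u_fun y / (2 * psi_fun y)) + s * f^`()%classic y =
        (N * u_fun y + s * (psi_fun y * f^`()%classic y)) / psi_fun y.
      by field; rewrite gt_eqF.
    apply: divr_ge0; last exact: ltW.
    by have := ler_wpM2l N0 u1; lra.
  - have cu : {within `[x, t], continuous (fun y : R => 2 * N * u_fun y)}.
      apply: continuous_subspaceT => y; apply: cvgM; first exact: cvg_cst.
      exact: continuous_u_fun.
    have cf := abs_continuous_within (acf x t x0 xt).
    by move=> y; apply: cvgD; [exact: cu|apply: cvgM; [exact: cvg_cst|exact: cf]].
have := mono 1 (normr1 _); have := mono (-1) (normrN1 _).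
have ut : 0 <= u_fun t - u_fun x.
  rewrite subr_ge0 lerD// ler_wsqrtr// lerD2l//.
by rewrite (ger0_norm ut) ler_norml; lra.
Qed.

(** * Sign of the second moment *)

Lemma Lambda2_ge0 (R : realType) (m : nat) (a x : R) :
  (0 < m)%N -> 1 < a -> 0 <= x -> 0 <= Lambda2 m a x.
Proof.
move=> m0 a1 x0; rewrite /Lambda2 szasz_kantorovichE// mulr_ge0//.
have l0 := poisson_parameter_ge0 m0 a1 x0.
apply: limr_ge; first exact: is_cvg_poisson_second_moment.
near=> n; apply: sumr_ge0 => k _; rewrite mulr_ge0 ?poisson_weight_ge0//.
by apply: Rintegral_ge0 => t _; exact: sqr_ge0.
Unshelve. all: by end_near. Qed.

(** At [x = 0] the term [k = 0] has weight 1 and contributes the integral of [t^2] over [[0, 1/m]],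
    which is positive. This makes the parameter of the K-functional [+oo] rather than
    [0 * +oo = 0]. *)
Lemma Lambda2_0_gt0 (R : realType) (m : nat) (a : R) : (0 < m)%N -> 1 < a ->
  0 < Lambda2 m a 0.
Proof.
move=> m0 a1; rewrite /Lambda2 szasz_kantorovichE//= !mul0r.
pose q k : R := poisson_weight 0 k * cell_integral m (fun t => (t - 0) ^+ 2) k.
rewrite pmulr_rgt0 ?ltr0n//.
have q0 k : 0 <= q k.
  rewrite mulr_ge0 ?poisson_weight_ge0//.
  by apply: Rintegral_ge0 => t _; exact: sqr_ge0.
have cq : cvgn (series q) by exact: is_cvg_poisson_second_moment.
have nd : {homo series q : i j / (i <= j)%N >-> i <= j}.
  exact: nondecreasing_series.
apply: lt_le_trans (nondecreasing_cvgn_le nd cq 1).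
rewrite /series/= big_nat1 /q /poisson_weight /exp_coeff /=.
rewrite {1}oppr0 expR0 expr0 fact0 divr1 !mul1r /cell_integral.
have csq : continuous (fun t : R => (t - 0) ^+ 2).
  exact: continuous_sqr_dist.
have dF (t : R) : is_derive t 1 (fun t : R => 3^-1 * t ^+ 3) ((t - 0) ^+ 2).
  have d3 := DeriveDef (@exprn_derivable _ 3 t 1) (@exp_derive _ 3 t 1).
  apply: is_derive_eq (is_deriveZ 3^-1 d3) _.
  by rewrite subr0 /= /GRing.scale/=; field.
have cF : continuous (fun t : R => 3^-1 * t ^+ 3).
  move=> t; apply: cvgM; first exact: cvg_cst.
  exact: exprn_continuous.
rewrite /Rintegral (continuous_FTC2 (F := fun t : R => 3^-1 * t ^+ 3)).
- rewrite /= mul0r expr0n/= mulr0 subr0 mulr_gt0 ?invr_gt0 ?ltr0n// exprn_gt0//.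
  by rewrite divr_gt0 ?ltr0n.
- by rewrite mul0r divr_gt0 ?ltr0n.
- exact: continuous_subspaceT csq.
- split.
  + by move=> t _; have [] := dF t.
  + exact: cvg_at_right_filter (cF _).
  + exact: cvg_at_left_filter (cF _).
- by move=> t _; rewrite derive1E; have [] := dF t.
Qed.

(** * From pointwise bounds to the K-functional *)

Lemma supnorm_ge (R : realType) (f : R -> R) (x : R) : 0 <= x ->
  (`|f x|%:E <= supnorm f)%E.
Proof.
by move=> x0; apply: ereal_sup_ubound; exists x => //=; rewrite in_itv/= x0.
Qed.

Lemma supnorm_ge0 (R : realType) (f : R -> R) : (0 <= supnorm f)%E.
Proof. by apply: le_trans (supnorm_ge f (lexx 0)). Qed.

(* AM-GM, [|t - x| <= S / 2 + (t - x)^2 / (2 S)] with [S = sqrt Lambda2 + e],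
   replaces the Cauchy-Schwarz inequality; the slack [e] keeps [S] positive. *)
Lemma szasz_kantorovich_lipschitz_dist (R : realType) (m : nat) (a x : R)
    (g : R -> R) (A K : R) :
  (0 < m)%N -> 1 < a -> 0 <= x -> {within `[0, +oo[, continuous g} -> 0 <= K ->
  (forall t, 0 <= t -> `|g t - g x| <= A + K * `|t - x|) ->
  `|szasz_kantorovich m a g x - g x| <= A + K * Num.sqrt (Lambda2 m a x).
Proof.
move=> m0 a1 x0 cg K0 dg; apply/ler_addgt0Pr => d d0.
have K1 : 0 < K + 1 by rewrite ltr_wpDl.
(* Dividing by [K + 1] ensures [K * e <= d] and also covers [K = 0]. *)
pose e := d / (K + 1); have e_gt0 : 0 < e by rewrite divr_gt0.
set r := Num.sqrt (Lambda2 m a x); have r0 : 0 <= r by exact: sqrtr_ge0.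
have rE : r ^+ 2 = Lambda2 m a x by rewrite sqr_sqrtr// Lambda2_ge0.
pose S := r + e; have S0 : 0 < S by rewrite ltr_wpDl.
have := @szasz_kantorovich_dist _ m a x g (A + K * (S / 2)) (K / (2 * S))
  m0 a1 x0 cg.
have dgS (t : R) : 0 <= t -> `|g t - g x| <=
    A + K * (S / 2) + K / (2 * S) * (t - x) ^+ 2.
  move=> t0; apply: le_trans (dg t t0) _; rewrite -addrA lerD2l.
  have -> : K * (S / 2) + K / (2 * S) * (t - x) ^+ 2 =
      K * ((S ^+ 2 + (t - x) ^+ 2) / (2 * S)) by field; rewrite gt_eqF.
  rewrite ler_wpM2l// ler_pdivlMr ?mulr_gt0// -(real_normK (num_real (t - x))).
  by have := sqr_ge0 (S - `|t - x|); lra.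
move=> /(_ dgS) h; apply: le_trans h _; rewrite -addrA -addrA lerD2l -rE.
have -> : K * (S / 2) + K / (2 * S) * r ^+ 2 =
    K * ((S ^+ 2 + r ^+ 2) / (2 * S)) by field; rewrite gt_eqF.
apply: (@le_trans _ _ (K * S)).
  rewrite ler_wpM2l// ler_pdivrMr ?mulr_gt0//.
  have : r ^+ 2 <= S ^+ 2 by rewrite ler_sqr ?nnegrE ?(ltW S0)// lerDl ltW.
  by lra.
rewrite /S mulrDr lerD2l /e mulrA ler_pdivrMr// mulrC ler_pM2l//.
by rewrite lerDl.
Qed.

(** The factor 2 has two sources: [f] replaces [g] at both [t] and [x], costing [2 D], and the
    increment of [f] is at most [2 N] times that of [u]. *)
Lemma szasz_kantorovich_approx (R : realType) (m : nat) (a x : R)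
    (f g : R -> R) (D N : R) :
  (0 < m)%N -> 1 < a -> 0 < x -> {within `[0, +oo[, continuous g} -> ACloc f ->
  (forall t, 0 <= t -> `|f t - g t| <= D) ->
  (forall y, 0 < y -> `|psi_fun y * f^`()%classic y| <= N) ->
  `|szasz_kantorovich m a g x - g x| <=
    2 * (D + u_fun x * Num.sqrt (Lambda2 m a x) / psi_fun x * N).
Proof.
move=> m0 a1 x0 cg ACf fD fN.
have N0 : 0 <= N by apply: le_trans (fN 1 ltr01).
have K0 : 0 <= 2 * N * (u_fun x / psi_fun x).
  by rewrite !mulr_ge0 ?invr_ge0 ?u_fun_ge0 ?sqrtr_ge0.
have -> : 2 * (D + u_fun x * Num.sqrt (Lambda2 m a x) / psi_fun x * N) =
    2 * D + 2 * N * (u_fun x / psi_fun x) * Num.sqrt (Lambda2 m a x) by ring.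
apply: szasz_kantorovich_lipschitz_dist => //; first exact: ltW.
move=> t t0; have -> : g t - g x = - (f t - g t) + (f t - f x) + (f x - g x).
  by ring.
apply: le_trans (ler_normD _ _) _.
apply: le_trans (lerD (ler_normD _ _) (lexx _)) _; rewrite normrN.
have dt := fD t t0; have dx := fD x (ltW x0).
have h1 := ACloc_dist_u_fun ACf fN (ltW x0) t0.
have h2 := ler_wpM2l (mulr_ge0 (ler0n R 2) N0) (u_fun_dist x0 t0).
have -> : 2 * N * (u_fun x / psi_fun x) * `|t - x| =
  2 * N * (`|t - x| * (u_fun x / psi_fun x)) by ring.
by lra.
Qed.

(** A vanishing weighted derivative makes [f] constant on [[0, +oo[], so the Lipschitz bound applies
    with slope 0. *)
Lemma szasz_kantorovich_approx0 (R : realType) (m : nat) (a : R)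
    (f g : R -> R) (D : R) :
  (0 < m)%N -> 1 < a -> {within `[0, +oo[, continuous g} -> ACloc f ->
  (forall t, 0 <= t -> `|f t - g t| <= D) ->
  (forall y, 0 < y -> `|psi_fun y * f^`()%classic y| <= 0) ->
  `|szasz_kantorovich m a g 0 - g 0| <= 2 * D.
Proof.
move=> m0 a1 cg ACf fD fN.
have -> : 2 * D = 2 * D + 0 * Num.sqrt (Lambda2 m a 0) by ring.
apply: szasz_kantorovich_lipschitz_dist => // t t0; rewrite mul0r addr0.
have := ACloc_dist_u_fun ACf fN (lexx 0) t0.
rewrite mulr0 mul0r normr_le0 subr_eq0 => /eqP ft.
have -> : g t - g 0 = - (f t - g t) + (f 0 - g 0) by rewrite ft; ring.
apply: le_trans (ler_normD _ _) _; rewrite normrN.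
by have := fD t t0; have := fD 0 (lexx 0); lra.
Qed.

(* The quotient is taken in the extended reals, where 0^-1 = +oo: at x = 0,
   where psi vanishes and u, Lambda2 do not, the parameter of K is +oo. *)
Theorem theorem2p2 (R : realType) (a : R) (ha : 1 < a)
    (g : R -> R) (hg : CB0y g)
    (m : nat) (hm : (0 < m)%N) (x : R) (hx : 0 <= x) :
  (`|szasz_kantorovich m a g x - g x|%:E <=
   2%:E * Kfunctional (@psi_fun R) g
     ((u_fun x * Num.sqrt (Lambda2 m a x))%:E / (psi_fun x)%:E))%E.
Proof.
case: hg => cg _.
(* The factor 2 moves inside the infimum, leaving one bound for each [f]. *)
rewrite /Kfunctional -ereal_inf_pZl//; apply: le_ereal_inf_tmp.
move=> _ [_ [f [ACf psi_f_fin] <-] <-].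
set e := (_ / _)%E; set N := supnorm (_ \* _); set D := supnorm (_ \- _).
have N0 : (0 <= N)%E by exact: supnorm_ge0.
have D0 : (0 <= D)%E by exact: supnorm_ge0.
have uL0 : 0 <= u_fun x * Num.sqrt (Lambda2 m a x).
  by rewrite mulr_ge0 ?u_fun_ge0 ?sqrtr_ge0.
have e0 : (0 <= e)%E by rewrite mule_ge0 ?lee_fin// inve_ge0 lee_fin sqrtr_ge0.
(* Membership in [Wspace] makes [N] finite but not [D]; an infinite [D] makes the bound trivial. *)
have [Dy|Dy] := eqVneq D +oo%E.
  rewrite Dy addye ?gt_eqF ?(lt_le_trans _ (mule_ge0 e0 N0))//.
  by rewrite gt0_muley ?leey// lte_fin.
have Dfin : D = (fine D)%:E by rewrite fineK// ge0_fin_numE// ltey.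
have Nfin : N = (fine N)%:E by rewrite fineK// ge0_fin_numE.
have fD t : 0 <= t -> `|f t - g t| <= fine D.
  by move=> t0; rewrite -lee_fin -Dfin (supnorm_ge (f \- g)).
have fN y : 0 < y -> `|psi_fun y * f^`()%classic y| <= fine N.
  move=> y0; rewrite -lee_fin -Nfin.
  have := supnorm_ge (@psi_fun R \* derive0y f) (ltW y0).
  by rewrite /= /derive0y gt_eqF.
have [x_eq0|x_neq0] := eqVneq x 0; last first.
  have x0 : 0 < x by rewrite lt0r x_neq0.
  have p0 : psi_fun x != 0 by rewrite gt_eqF// sqrtr_gt0 mulr_gt0// addr_gt0.
  have -> : e = (u_fun x * Num.sqrt (Lambda2 m a x) / psi_fun x)%:E.
    by rewrite /e inver (negbTE p0) -EFinM.
  rewrite Dfin Nfin -(EFinM _ (fine N)) -EFinD -EFinM lee_fin.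
  exact: szasz_kantorovich_approx ACf fD fN.
rewrite {}x_eq0 in uL0 e e0 *.
have ey : e = +oo%E.
  rewrite /e inver /psi_fun mul0r sqrtr0 eqxx gt0_muley// lte_fin.
  rewrite mulr_gt0 ?sqrtr_gt0 ?Lambda2_0_gt0//.
  by rewrite (lt_le_trans ltr01)// u_fun_ge1.
(* With parameter [+oo], a positive [N] makes the right-hand side infinite, while [N = 0] leaves
   only [2 D] since [+oo * 0 = 0]. *)
have [N_eq0|N_neq0] := eqVneq N 0%E; last first.
  have Npos : (0 < N)%E by rewrite lt0e N_neq0.
  rewrite ey gt0_mulye// addey ?gt_eqF ?(lt_le_trans _ D0)//.
  by rewrite gt0_muley ?leey// lte_fin.
rewrite N_eq0 mule0 adde0 Dfin -EFinM lee_fin.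
by apply: szasz_kantorovich_approx0 ACf fD _ => //; rewrite N_eq0 in fN.
Qed.
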